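(* Let $V_1,\ldots,V_i$ denote $i$ random (that is, arbitrary) vertices in an $m\times n$ GIG digraph, where their labels follow $v_1<\cdots<v_i$. For $1\le j\le i$ let $K_j=|N(V_1,\ldots,V_j)|$. The probability that $V_1,\ldots,V_i$ are sinks (with their labels in this order) is $$\frac{1}{K_1}\cdot\frac{1}{K_2}\cdots\frac{1}{K_i}.$$
   Context: The vertex set $V$ is the $m\times n$ integer lattice $\{1,\ldots,m\}\times\{1,\ldots,n\}$. Two vertices are called neighbors if they are at Euclidean distance exactly $1$ in the lattice (neighbor refers to lattice proximity, not to adjacency in the digraph). For $W\subset V$, $N(W)$ is the set consisting of the vertices of $W$ together with all neighbors of vertices of $W$; $N(V_1,\ldots,V_j)$ means $N(\{V_1,\ldots,V_j\})$. A labeling assigns the distinct labels $1,\ldots,mn$ to the vertices of $V$; the label of $V_a$ is denoted $v_a$, and $n(W)$ denotes the set of labels of the vertices in $N(W)$. The GIG (Greatest Increase Grid) digraph of a labeling is the digraph on $V$ in which $(V_a,V_b)$ is a directed edge if and only if $a\ne b$ and $v_b=\max n(\{V_a\})$. A vertex is a sink if its outdegree is $0$. The probability refers to a randomly labeled $m\times n$ GIG digraph, that is, the GIG digraph of a labeling chosen uniformly at random among all $(mn)!$ labelings. The ordering $v_1<\cdots<v_i$ is part of the event whose probability is given: the probability that $i$ given vertices are all sinks, with no order prescribed, is obtained by summing the formula over the $i!$ possible orders of their labels.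
   Formalization: The vertices are additionally assumed pairwise non-neighboring (and distinct): if two of them are neighbors they cannot both be sinks, so the probability is 0 while the product is positive (e.g. both vertices of the 1×2 grid: 0 versus 1/4). *)

(* Defs.v *)
From mathcomp Require Import all_boot all_order all_algebra all_field.

Set Implicit Arguments.
Unset Strict Implicit.
Unset Printing Implicit Defensive.

Import Order.TTheory GRing.Theory Num.Theory.

Local Open Scope ring_scope.

(* The lattice {1..m} x {1..n}, with both coordinates shifted down by 1. *)
Notation vertex m n := ('I_m * 'I_n)%type.

(* Valued in algC because boolean equality and square roots are both needed. *)
Definition euclidean_dist m n (a b : vertex m n) : algC :=
  sqrtC ((a.1%:R - b.1%:R) ^+ 2 + (a.2%:R - b.2%:R) ^+ 2).

Definition neighbor m n (a b : vertex m n) : bool := euclidean_dist a b == 1.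

Definition nbhd m n (W : {set vertex m n}) : {set vertex m n} :=
  W :|: [set b | [exists a in W, neighbor a b]].

(* As #|vertex m n| = m * n, the injective functions are the bijections. *)
Definition labelings m n : {set {ffun vertex m n -> 'I_(m * n)}} :=
  [set l : {ffun vertex m n -> 'I_(m * n)} | injectiveb l].

(* Shifts the values of l from {0, ..., mn - 1} to the labels {1, ..., mn}. *)
Definition label m n (l : {ffun vertex m n -> 'I_(m * n)}) (a : vertex m n) :
  nat := (l a).+1.

Definition max_nbhd_label m n (l : {ffun vertex m n -> 'I_(m * n)})
  (W : {set vertex m n}) : nat := (\max_(c in nbhd W) label l c)%N.

Definition gig_edge m n (l : {ffun vertex m n -> 'I_(m * n)}) :
  rel (vertex m n) :=
  fun a b => (a != b) && (label l b == max_nbhd_label l [set a]).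

Definition outdegree m n (l : {ffun vertex m n -> 'I_(m * n)})
  (a : vertex m n) : nat := #|[set b | gig_edge l a b]|.

Definition sink m n (l : {ffun vertex m n -> 'I_(m * n)}) (a : vertex m n) :
  bool := outdegree l a == 0%N.

Definition prob_labeling m n (E : pred {ffun vertex m n -> 'I_(m * n)}) : rat :=
  #|[set l in labelings m n | E l]|%:R / #|labelings m n|%:R.

Definition ordered_sinks m n i (V : 'I_i -> vertex m n) :
  pred {ffun vertex m n -> 'I_(m * n)} :=
  fun l => [forall j, sink l (V j)] &&
    [forall j : 'I_i, forall k : 'I_i,
       (j < k)%N ==> (label l (V j) < label l (V k))%N].

Definition nbhd_size m n i (V : 'I_i -> vertex m n) (j : 'I_i) : nat :=
  #|nbhd [set V k | k : 'I_i & (k <= j)%N]|.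

Lemma card_labelings m n : #|labelings m n| = (m * n)`!.
Proof.
have := card_inj_ffuns (vertex m n) 'I_(m * n).
by rewrite card_prod !card_ord ffactnn cardsE.
Qed.

Lemma sink_max m n (l : {ffun vertex m n -> 'I_(m * n)}) (a : vertex m n) :
  sink l a -> label l a = max_nbhd_label l [set a].
Proof.
have aN : a \in nbhd [set a] by rewrite !inE eqxx.
have [c cN mE] := @eq_bigmax_cond _ (mem (nbhd [set a])) (label l)
  (introT card_gt0P (ex_intro _ a aN)).
rewrite /sink /outdegree cards_eq0 => /eqP /setP /(_ c).
rewrite !inE /gig_edge /max_nbhd_label mE eqxx andbT => /negbFE/eqP-> //.
Qed.

(* The theorem requires V to have no two neighbors: otherwise the event below
   is impossible, whereas the product of the 1 / K_j is positive. *)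
Lemma prob_ordered_sinks_neighbor m n i (V : 'I_i -> vertex m n) (j k : 'I_i) :
  (j < k)%N -> neighbor (V j) (V k) -> prob_labeling (ordered_sinks V) = 0.
Proof.
move=> jk nb; rewrite /prob_labeling (_ : [set _ in _ | _] = set0) ?cards0 ?mul0r //.
apply/setP => l; rewrite !inE; apply/negP => /andP[_ /andP[/forallP sk]].
move=> /forallP/(_ j)/forallP/(_ k); rewrite jk /= ltnNge (sink_max (sk j)).
rewrite /max_nbhd_label (@leq_bigmax_cond _ (mem (nbhd [set V j])) (label l)) //.
by rewrite !inE; apply/orP; right; apply/existsP; exists (V j); rewrite inE eqxx.
Qed.

(* Main.v *)
(* Write A_j = N(V_1, ..., V_j). Since V_j lies outside A_k for k < j, the event
   says exactly that, for every j, the label of V_j is the largest label on A_j.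
   Let G_j be the set of labelings that satisfy this condition for all indices
   >= j. Transposing V_j with another vertex of A_j fixes every later V_k and
   preserves every later A_k, hence preserves G_(j+1); so, within G_(j+1), each
   vertex of A_j is equally often the one with the largest label on A_j, and
   |G_j| * |A_j| = |G_(j+1)|. *)
Require Import Defs.
From mathcomp Require Import all_boot all_order all_algebra all_field all_fingroup.

Set Implicit Arguments.
Unset Strict Implicit.
Unset Printing Implicit Defensive.

Import Order.TTheory GRing.Theory Num.Theory.

Local Open Scope ring_scope.

(** * Largest labels and relabeling by permutations *)

Definition is_argmax (T : finType) N (l : {ffun T -> 'I_N}) (A : {set T})
  (a : T) : bool := [forall b in A, (l b <= l a)%N].

Lemma is_argmaxP (T : finType) N (l : {ffun T -> 'I_N}) (A : {set T}) (a : T) :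
  reflect (forall b, b \in A -> (l b <= l a)%N) (is_argmax l A a).
Proof. exact: forall_inP. Qed.

Definition relabel (T : finType) N (s : {perm T}) (l : {ffun T -> 'I_N}) :
  {ffun T -> 'I_N} := [ffun x => l (s x)].

Lemma relabelK (T : finType) N (s : {perm T}) :
  cancel (@relabel T N s) (relabel s^-1).
Proof. by move=> l; apply/ffunP => x; rewrite !ffunE permKV. Qed.

(** Since [s] maps [A] onto itself, relabeling only rearranges the labels on [A], and [a] receives
    the label of [s a]. *)
Lemma is_argmax_relabel (T : finType) N (s : {perm T}) (l : {ffun T -> 'I_N})
  (A : {set T}) (a : T) :
  perm_on A s -> is_argmax (relabel s l) A a = is_argmax l A (s a).
Proof.
move=> sA; apply/is_argmaxP/is_argmaxP => h b bA.
  have := h (s^-1%g b); rewrite !ffunE permKV; apply.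
  by rewrite -(perm_closed _ sA) permKV.
by rewrite !ffunE h // perm_closed.
Qed.

(** * Counting along an increasing chain of sets *)

Section Chain.

Variables (T : finType) (N i : nat) (A : 'I_i -> {set T}) (v : 'I_i -> T).

(** The set [G_j], for an abstract chain. The index is a [nat] so that [j = i], where no condition
    remains, is allowed. *)
Definition argmax_from (j : nat) : {set {ffun T -> 'I_N}} :=
  [set l : {ffun T -> 'I_N} | injectiveb l &
     [forall k : 'I_i, (j <= k)%N ==> is_argmax l (A k) (v k)]].

Lemma argmax_fromP j (l : {ffun T -> 'I_N}) :
  reflect (injective l /\
           forall k : 'I_i, (j <= k)%N -> is_argmax l (A k) (v k))
          (l \in argmax_from j).
Proof.
rewrite inE; apply: (iffP andP) => -[/injectiveP il h]; split=> //.
  by move=> k jk; apply: (implyP (forallP h k)).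
by apply/forallP => k; apply/implyP; apply: h.
Qed.

Hypothesis A_mono : forall j k : 'I_i, (j <= k)%N -> A j \subset A k.
Hypothesis v_in : forall j, v j \in A j.
Hypothesis v_notin : forall j k : 'I_i, (j < k)%N -> v k \notin A j.

Lemma relabel_argmax_from (j : 'I_i) (s : {perm T}) (l : {ffun T -> 'I_N}) :
  perm_on (A j) s -> l \in argmax_from j.+1 -> relabel s l \in argmax_from j.+1.
Proof.
move=> sA /argmax_fromP[il h]; apply/argmax_fromP; split.
  by move=> x y; rewrite !ffunE => /il/perm_inj.
move=> k jk; rewrite is_argmax_relabel ?(out_perm sA) ?h ?v_notin //.
exact: subset_trans sA (A_mono (ltnW jk)).
Qed.

Lemma argmax_from_now (j : 'I_i) (l : {ffun T -> 'I_N}) :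
  (l \in argmax_from j) = (l \in argmax_from j.+1) && is_argmax l (A j) (v j).
Proof.
apply/argmax_fromP/andP => [[il h]|[/argmax_fromP[il h] hj]].
  by split; [apply/argmax_fromP; split=> // k /ltnW; apply: h | apply: h].
split=> // k; rewrite leq_eqVlt => /orP[/eqP jk|]; last exact: h.
by rewrite -(val_inj jk : j = k).
Qed.

(** Relabeling by the transposition of [u] and [v j] is a bijection between the labelings counted on
    the left and [argmax_from j]. *)
Lemma card_argmax_at (j : 'I_i) (u : T) : u \in A j ->
  #|[set l in argmax_from j.+1 | is_argmax l (A j) u]| = #|argmax_from j|.
Proof.
move=> uA; pose s := tperm u (v j).
have sA : perm_on (A j) s.
  by apply/subsetP => x; rewrite inE; case: tpermP => [->|->|] //; rewrite eqxx.
rewrite -(card_imset _ (can_inj (relabelK s))); apply: eq_card => l.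
rewrite argmax_from_now; apply/imsetP/andP => [[l' ]|[hl hv]].
  rewrite inE => /andP[hl' hu] ->; split; first exact: relabel_argmax_from.
  by rewrite is_argmax_relabel // tpermR.
exists (relabel s l).
  by rewrite inE relabel_argmax_from //= is_argmax_relabel // tpermL.
by rewrite -{1}(relabelK s l) /s tpermV.
Qed.

(** Double counting of the pairs [(l, u)] where [u] has the largest label of [l] on [A j]. *)
Lemma card_argmax_from_step (j : 'I_i) :
  (#|argmax_from j| * #|A j| = #|argmax_from j.+1|)%N.
Proof.
have card1 l : l \in argmax_from j.+1 ->
    (\sum_(u in A j) is_argmax l (A j) u)%N = 1%N.
  move=> /argmax_fromP[il _].
  (* A maximum exists because [A j] contains [v j]; it is unique because [l] is injective. *)
  have [a aA amax] := arg_maxnP (fun x => nat_of_ord (l x)) (v_in j).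
  rewrite (bigD1 a) //= (_ : is_argmax l (A j) a); last exact/is_argmaxP.
  rewrite big1 ?addn0 // => b /andP[bA]; apply: contraNeq.
  rewrite eqb0 negbK => /is_argmaxP/(_ a aA) ab.
  by apply/eqP/il/val_inj/eqP; rewrite eqn_leq ab andbT; apply: amax.
rewrite mulnC -sum_nat_const -[RHS]sum1_card.
rewrite -(eq_bigr _ card1) exchange_big /=; apply: eq_bigr => u uA.
rewrite -(card_argmax_at uA) -sum1dep_card big_mkcondr /=.
by apply: eq_bigr => l _; case: is_argmax.
Qed.

Lemma card_argmax_from0 :
  (#|argmax_from 0| * \prod_(j < i) #|A j|
   = #|[set l : {ffun T -> 'I_N} | injectiveb l]|)%N.
Proof.
have partial d : (d <= i)%N ->
    (#|argmax_from 0| * \prod_(j < i | (j < d)%N) #|A j| = #|argmax_from d|)%N.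
  elim: d => [|d IHd] di; first by rewrite big_pred0 ?muln1.
  rewrite (bigD1 (Ordinal di)) //= mulnCA.
  rewrite (eq_bigl (fun j : 'I_i => (j < d)%N)); last first.
    by move=> j; rewrite ltnS ltn_neqAle andbC.
  by rewrite (IHd (ltnW di)) mulnC (card_argmax_from_step (Ordinal di)).
rewrite (eq_bigl (fun j : 'I_i => (j < i)%N)) => [|j]; last by rewrite ltn_ord.
(* At [d = i] the condition defining [argmax_from] is vacuous. *)
rewrite partial //; apply: eq_card => l; rewrite !inE.
by rewrite [X in _ && X](_ : _ = true) ?andbT //; apply/forallP => k;
  rewrite leqNgt ltn_ord.
Qed.

End Chain.

(** * Sinks and neighborhoods in the lattice *)

Lemma mem_nbhd m n (W : {set vertex m n}) (b : vertex m n) :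
  (b \in nbhd W) = [exists a in W, b \in nbhd [set a]].
Proof.
apply/idP/exists_inP => [|[a aW]]; rewrite !inE.
  case/orP => [bW|/exists_inP[a aW ab]]; first by exists b; rewrite // !inE eqxx.
  exists a => //; rewrite !inE; apply/orP; right.
  by apply/exists_inP; exists a; rewrite ?inE.
case/orP => [/eqP->|/exists_inP[c]]; first by rewrite aW.
rewrite inE => /eqP-> ab; apply/orP; right.
by apply/exists_inP; exists a.
Qed.

(** The only possible out-edge of [a] leads to the vertex with the largest label around it; by
    injectivity it is absent when that vertex is [a] itself. *)
Lemma sink_is_argmax m n (l : {ffun vertex m n -> 'I_(m * n)})
  (a : vertex m n) :
  injective l -> sink l a = is_argmax l (nbhd [set a]) a.
Proof.
move=> il; apply/idP/is_argmaxP => [sk b bN|h].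
  rewrite -ltnS -/(label l b) -[X in (_ <= X)%N]/(label l a) (sink_max sk).
  exact: (@leq_bigmax_cond _ (mem (nbhd [set a])) (label l)).
rewrite /sink /outdegree cards_eq0; apply/eqP/setP => b; rewrite !inE.
apply/negbTE/negP => /andP[/eqP ab /eqP lb]; apply/ab/il/val_inj/succn_inj.
rewrite -[RHS]/(label l b) lb; apply/eqP; rewrite eqn_leq; apply/andP; split.
  apply: (@leq_bigmax_cond _ (mem (nbhd [set a])) (label l)).
  by rewrite !inE eqxx.
by apply/bigmax_leqP => c cN; rewrite /label ltnS h.
Qed.

Section OrderedSinks.

Variables (m n i : nat) (V : 'I_i -> vertex m n).

(** The concrete [A_j]; its cardinality is [nbhd_size V j] by conversion. *)
Definition initial_nbhd (j : 'I_i) : {set vertex m n} :=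
  nbhd [set V k | k : 'I_i & (k <= j)%N].

Lemma initial_nbhdP (j : 'I_i) (b : vertex m n) :
  reflect (exists2 k : 'I_i, (k <= j)%N & b \in nbhd [set V k])
          (b \in initial_nbhd j).
Proof.
rewrite /initial_nbhd mem_nbhd; apply: (iffP exists_inP) => [[a]|[k kj bN]].
  by case/imsetP => k; rewrite inE => kj -> bN; exists k.
by exists (V k) => //; apply: imset_f; rewrite inE.
Qed.

Lemma initial_nbhd_mono (j k : 'I_i) :
  (j <= k)%N -> initial_nbhd j \subset initial_nbhd k.
Proof.
move=> jk; apply/subsetP => b /initial_nbhdP[h hj bN].
by apply/initial_nbhdP; exists h => //; apply: leq_trans hj jk.
Qed.

Lemma initial_nbhd_in (j k : 'I_i) : (k <= j)%N -> V k \in initial_nbhd j.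
Proof. by move=> kj; apply/initial_nbhdP; exists k; rewrite // !inE eqxx. Qed.

Hypothesis V_distinct : injective V.
Hypothesis V_nonneighbor : forall j k : 'I_i, ~~ neighbor (V j) (V k).

Lemma initial_nbhd_notin (j k : 'I_i) : (j < k)%N -> V k \notin initial_nbhd j.
Proof.
move=> jk; apply/initial_nbhdP => -[h hj]; rewrite !inE.
case/orP => [/eqP/V_distinct kh|/exists_inP[a]].
  by move: hj; rewrite -kh leqNgt jk.
by rewrite inE => /eqP->; apply/negP.
Qed.

Lemma ordered_sinks_argmax_from :
  [set l in labelings m n | ordered_sinks V l]
  = argmax_from (m * n) initial_nbhd V 0.
Proof.
apply/setP => l; rewrite !inE; case: injectiveP => //= il.
apply/andP/forallP => [[/forallP sk /forallP ord] j|h].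
  (* With [b] in the neighborhood of [V k] and [k <= j], the sink property and the order give
     [l b <= l (V k) <= l (V j)]. *)
  apply/is_argmaxP => b /initial_nbhdP[k kj bN].
  have lbk : (l b <= l (V k))%N.
    by move: (sk k); rewrite sink_is_argmax // => /is_argmaxP; apply.
  apply: (leq_trans lbk); move: kj; rewrite leq_eqVlt => /orP[/eqP kj|kj].
    by rewrite (val_inj kj : k = j).
  by apply: ltnW; exact: (implyP (forallP (ord k) j) kj).
have argmaxV (j : 'I_i) b : b \in initial_nbhd j -> (l b <= l (V j))%N.
  exact: is_argmaxP (h j) b.
split; apply/forallP => j.
  rewrite sink_is_argmax //; apply/is_argmaxP => b bN; apply: argmaxV.
  by apply/initial_nbhdP; exists j.
(* The order is recovered from [V j] lying in [initial_nbhd k]; it is strict because [l] and [V] are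
   injective. *)
apply/forallP => k; apply/implyP => jk; rewrite /label ltnS ltn_neqAle.
rewrite argmaxV ?initial_nbhd_in ?(ltnW jk) // andbT.
by apply/eqP => /val_inj/il/V_distinct jk'; rewrite jk' ltnn in jk.
Qed.

End OrderedSinks.

Theorem theorem3p1 (m n i : nat) (V : 'I_i -> 'I_m * 'I_n)
    (V_distinct : injective V)
    (V_nonneighbor : forall j k : 'I_i, ~~ neighbor (V j) (V k)) :
  prob_labeling (ordered_sinks V) = \prod_(j < i) (1 / (nbhd_size V j)%:R).
Proof.
have K_gt0 (j : 'I_i) : (0 < nbhd_size V j)%N.
  by apply/card_gt0P; exists (V j); apply: initial_nbhd_in.
have count := card_argmax_from0 (m * n) (@initial_nbhd_mono _ _ _ V)
  (fun j => initial_nbhd_in V (leqnn j))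
  (initial_nbhd_notin V_distinct V_nonneighbor).
rewrite /prob_labeling (ordered_sinks_argmax_from V_distinct).
under eq_bigr => j _ do rewrite div1r.
rewrite prodfV -natr_prod.
have P_neq0 : (\prod_(j < i) nbhd_size V j)%:R != 0 :> rat.
  by rewrite pnatr_eq0 -lt0n prodn_gt0.
have L_neq0 : #|labelings m n|%:R != 0 :> rat.
  by rewrite pnatr_eq0 -lt0n card_labelings fact_gt0.
(* Multiplying by the product of the [K_j] turns the numerator into the number of all labelings, by
   [count]. *)
apply: (mulIf P_neq0); rewrite mulVf // mulrAC -natrM.
by rewrite [X in X%:R / _]count divff.
Qed.
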